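(* Consider a classification task with class set $\mathcal{Y}$ and class descriptions $\{v_y\}_{y\in\mathcal{Y}}$, let $\{r_y\}_{y\in\mathcal{Y}}\subset\Gamma$ be the verbalizers used for the classes, and let $z^*$ be the value of the latent variable $z$ representing that each description $v_y$ is associated with the corresponding verbalizer $r_y$. Let $x_1,x_2,\dots$ be inputs, let $r_t$ be the correct verbalizer for $x_t$ (that is, $r_t=r_y$ where $y$ is the label of $x_t$), let $d$ be the delimiter, and let $S_t = x_1, r_1, d, x_2, r_2, d, \dots, x_t, r_t, d$, with $S_0$ the empty sequence. Then for every positive integer $T$, $$\frac{1}{T}\sum_{t=1}^T \log \Pr(r_t \mid x_t, S_{t-1}) \;\geq\; \frac{1}{T}\log \Pr(z^* ) + \frac{1}{T}\sum_{t=1}^T \log \Pr(r_t, d \mid x_t, z^*, S_{t-1}) + \frac{1}{T}\sum_{t=1}^T \log \frac{\Pr(x_t\mid z^*, S_{t-1})}{\Pr(x_t\mid S_{t-1})}.$$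
   Context: Language model as a latent variable model. A document is a concatenation of paragraphs separated by a delimiter $d$. There is a set $\Gamma$ of words (expressions) that can be associated with variable meanings. A discrete latent variable $z$, with prior $\Pr(z)$, specifies which meaning each expression in the document is associated with, consistently throughout the document. Given $z$, the document is drawn from a conditional distribution $\Pr(\cdot\mid z)$, and the language model's distribution is the marginal $\Pr(\cdot)=\sum_z \Pr(z)\Pr(\cdot\mid z)$. A prompt is a sequence of consecutive blocks input, verbalizer, delimiter, input, verbalizer, delimiter, and so on. Here $\Pr(S_t)$ and $\Pr(S_t\mid z)$ are the probabilities that a document begins with the sequence $S_t$ of blocks. All conditional probabilities are formed from the joint distribution of $z$ and the blocks: for example, $\Pr(r_t\mid x_t,S_{t-1})$ is the conditional probability that the block following $S_{t-1},x_t$ is $r_t$; $\Pr(r_t,d\mid x_t,z^*,S_{t-1})$ is the conditional probability, given $z=z^*$, that the two blocks following $S_{t-1},x_t$ are $r_t$ and $d$; and $\Pr(x_t\mid S_{t-1})$ is the conditional probability that the block following $S_{t-1}$ is $x_t$. The sequences considered are such that these conditional probabilities and logarithms are well defined, i.e. $\Pr(z^* )>0$ and $\Pr(S_T\mid z^* )>0$. A classification task maps inputs to classes in $\mathcal{Y}$, and each class $y\in\mathcal{Y}$ is described by a natural-language description $v_y$. A verbalizer $r_y\in\Gamma$ is the expression used in the prompt in place of the class $y$. *)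

(* Defs.v *)
From HB Require Import structures.
From mathcomp Require Import all_boot all_order all_algebra.
From mathcomp Require Import all_classical all_reals all_analysis.

Set Implicit Arguments.
Unset Strict Implicit.
Unset Printing Implicit Defensive.

Import Order.TTheory GRing.Theory Num.Theory.

Local Open Scope classical_set_scope.
Local Open Scope ring_scope.

(* Discrete distributions; the type T need not be countable, but [pmf_sum1]
   makes the support so. *)
Record distribution (R : realType) (T : choiceType) := Distribution {
  pmf :> T -> R;
  pmf_ge0 : forall t, 0 <= pmf t;
  pmf_sum1 : (\esum_(t in [set: T]) (pmf t)%:E = 1)%E }.

Definition prob (R : realType) (T : choiceType) (p : distribution R T)
    (A : set T) : \bar R :=
  (\esum_(t in A) (p t)%:E)%E.

(* A document is a finite sequence of blocks of text; inputs, expressions (in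
   particular verbalizers) and the delimiter are all blocks. A value [z] of the
   latent variable associates with each expression in [Gamma] the meaning
   [meaning_of z e]. *)
Record language_model (R : realType) (Block Latent : choiceType)
    (Meaning : Type) := LanguageModel {
  delimiter : Block;
  Gamma : set Block;
  meaning_of : Latent -> Gamma -> Meaning;
  prior : distribution R Latent;
  document_given : Latent -> distribution R (seq Block) }.

Record classification_task (Block : choiceType) (Meaning : Type) :=
  ClassificationTask {
  input : set Block;
  class : Type;
  label : input -> class;
  description : class -> Meaning }.

Section LanguageModelProbabilities.
Context (R : realType) (Block Latent : choiceType) (Meaning : Type).
Variable lm : language_model R Block Latent Meaning.

Definition begins_with (s : seq Block) : set (seq Block) :=
  [set w | prefix s w].

(* Pr(s | z) *)
Definition Pr_given (z : Latent) (s : seq Block) : R :=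
  fine (prob (document_given lm z) (begins_with s)).

(* Joint probability that z lies in Z and that the document begins with s;
   for Z = [set: Latent] this is the marginal Pr(s) = \sum_z Pr(z) Pr(s | z). *)
Definition Pr_joint (Z : set Latent) (s : seq Block) : R :=
  fine (\esum_(z in Z)
    ((prior lm z)%:E * prob (document_given lm z) (begins_with s)))%E.

(* Pr(u | s) and Pr(u | z, s): conditional probability that the blocks
   following s are u. *)
Definition Pr_next (s u : seq Block) : R :=
  Pr_joint [set: Latent] (s ++ u) / Pr_joint [set: Latent] s.

Definition Pr_next_given (z : Latent) (s u : seq Block) : R :=
  Pr_joint [set z] (s ++ u) / Pr_joint [set z] s.

End LanguageModelProbabilities.

Section Prompts.
Context (R : realType) (Block Latent : choiceType) (Meaning : Type).
Variables (lm : language_model R Block Latent Meaning).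
Variables (task : classification_task Block Meaning).
Variable (r : class task -> Gamma lm).

Definition represents (z : Latent) : Prop :=
  forall y : class task, meaning_of z (r y) = description y.

Definition input_block (x : nat -> input task) (t : nat) : Block :=
  set_val (x t).

Definition correct_verbalizer (x : nat -> input task) (t : nat) : Block :=
  set_val (r (label (x t))).

(* S_t = x_1, r_1, d, ..., x_t, r_t, d. The inputs are indexed from 1, so that
   x 0 is not used. *)
Definition prompt (x : nat -> input task) (t : nat) : seq Block :=
  flatten [seq [:: input_block x i; correct_verbalizer x i; delimiter lm]
          | i <- iota 1 t].

End Prompts.

(* Main.v *)
(* Let m(s) be the probability that a document begins with s, and g(s) the joint
   probability of this event and z = zstar. The t-th summands on the right add
   up to ln (g(S_t) / g(S_{t-1})) - ln (m(S_{t-1}, x_t) / m(S_{t-1})), and on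
   the left m(S_{t-1}, x_t, r_t) >= m(S_t). So the t-th summands differ by at
   least the increment from t-1 to t of the potential ln (m(S_t) / g(S_t)),
   which is at most - ln Pr(zstar) at t = 0 and, because g <= m, nonnegative
   at t = T. *)
Require Import Defs.
From HB Require Import structures.
From mathcomp Require Import all_boot all_order all_algebra.
From mathcomp Require Import all_classical all_reals all_analysis.
From mathcomp Require Import lra.

Set Implicit Arguments.
Unset Strict Implicit.
Unset Printing Implicit Defensive.

Import Order.TTheory GRing.Theory Num.Theory.

Local Open Scope classical_set_scope.
Local Open Scope ring_scope.

(** Extending [a] by zero outside [A] and outside [B] turns both sides into sums over the whole
    type, which compare term by term. *)
Lemma esum_subset (R : realType) (T : choiceType) (A B : set T)
    (a : T -> \bar R) :
  (forall t, 0 <= a t)%E -> A `<=` B ->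
  (\esum_(t in A) a t <= \esum_(t in B) a t)%E.
Proof.
move=> a_ge0 AB; rewrite esum_mkcond [leRHS]esum_mkcond; apply: le_esum => t _.
case: ifPn => [/set_mem /AB /mem_set ->//|_].
by case: ifPn.
Qed.

Section Probabilities.
Context (R : realType) (Block Latent : choiceType) (Meaning : Type)
        (lm : language_model R Block Latent Meaning).

(* The qualified names are needed because all_analysis also has a
   [distribution] and a [pmf]. *)
Lemma prob_ge0 (T : choiceType) (p : Defs.distribution R T) (A : set T) :
  (0 <= prob p A)%E.
Proof. by apply: esum_ge0 => t _; rewrite lee_fin Defs.pmf_ge0. Qed.

Lemma prob_le1 (T : choiceType) (p : Defs.distribution R T) (A : set T) :
  (prob p A <= 1)%E.
Proof.
rewrite -(Defs.pmf_sum1 p); apply: esum_subset => // t.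
by rewrite lee_fin Defs.pmf_ge0.
Qed.

Lemma le_prob (T : choiceType) (p : Defs.distribution R T) (A B : set T) :
  A `<=` B -> (prob p A <= prob p B)%E.
Proof.
by move=> AB; apply: esum_subset => // t; rewrite lee_fin Defs.pmf_ge0.
Qed.

Lemma prob_fin_num (T : choiceType) (p : Defs.distribution R T) (A : set T) :
  prob p A \is a fin_num.
Proof.
rewrite fin_numElt (lt_le_trans _ (prob_ge0 p A)) ?ltNy0//.
by rewrite (le_lt_trans (prob_le1 p A)) ?ltry.
Qed.

Lemma begins_with_prefix (s s' : seq Block) :
  prefix s s' -> begins_with s' `<=` begins_with s.
Proof. by move=> ss' w; apply: prefix_trans. Qed.

Lemma Pr_given_prefix z s s' :
  prefix s s' -> Pr_given lm z s' <= Pr_given lm z s.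
Proof.
move=> ss'; apply: fine_le; rewrite ?prob_fin_num//.
exact/le_prob/begins_with_prefix.
Qed.

Let joint (s : seq Block) (z : Latent) : \bar R :=
  ((prior lm z)%:E * prob (document_given lm z) (begins_with s))%E.

Let joint_ge0 s z : (0 <= joint s z)%E.
Proof. by rewrite mule_ge0 ?lee_fin ?Defs.pmf_ge0 ?prob_ge0. Qed.

Let joint_le_prior s z : (joint s z <= (prior lm z)%:E)%E.
Proof.
by rewrite -[leRHS]mule1 lee_wpmul2l ?prob_le1 ?lee_fin ?Defs.pmf_ge0.
Qed.

Let esum_joint_le1 Z s : (\esum_(z in Z) joint s z <= 1)%E.
Proof.
apply: le_trans (prob_le1 (prior lm) Z).
by apply: le_esum => z _; apply: joint_le_prior.
Qed.

(** Finiteness ensures that [fine] in [Pr_joint] loses nothing, so inequalities between extended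
    sums pass to the reals. *)
Let esum_joint_fin_num Z s : (\esum_(z in Z) joint s z)%E \is a fin_num.
Proof.
rewrite fin_numElt (@lt_le_trans _ _ 0%E) ?ltNy0 ?esum_ge0//=.
by rewrite (le_lt_trans (esum_joint_le1 Z s)) ?ltry.
Qed.

Lemma Pr_joint_le1 Z s : Pr_joint lm Z s <= 1.
Proof. by rewrite -lee_fin fineK ?esum_joint_fin_num ?esum_joint_le1. Qed.

Lemma Pr_joint_prefix Z s s' :
  prefix s s' -> Pr_joint lm Z s' <= Pr_joint lm Z s.
Proof.
move=> ss'; apply: fine_le; rewrite ?esum_joint_fin_num//.
apply: le_esum => z _; rewrite lee_wpmul2l ?lee_fin ?Defs.pmf_ge0//.
exact/le_prob/begins_with_prefix.
Qed.

Lemma Pr_joint_subset Z Z' s :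
  Z `<=` Z' -> Pr_joint lm Z s <= Pr_joint lm Z' s.
Proof.
move=> ZZ'; apply: fine_le; rewrite ?esum_joint_fin_num//.
by apply: esum_subset => // z; apply: joint_ge0.
Qed.

Lemma Pr_joint_set1 z s :
  Pr_joint lm [set z] s = prior lm z * Pr_given lm z s.
Proof. by rewrite /Pr_joint esum_set1 ?joint_ge0// fineM ?prob_fin_num. Qed.

Lemma Pr_given_nil z : Pr_given lm z [::] = 1.
Proof.
rewrite /Pr_given (_ : begins_with [::] = setT) ?/prob ?Defs.pmf_sum1//.
by apply/seteqP; split=> w //= _; apply: prefix0s.
Qed.

End Probabilities.

(** The new round is split after its input, because that is the context in which the next verbalizer
    is predicted. *)
Lemma promptS (R : realType) (Block Latent : choiceType) (Meaning : Type)
    (lm : language_model R Block Latent Meaning)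
    (task : classification_task Block Meaning) (r : class task -> Gamma lm)
    (x : nat -> input task) (t : nat) :
  prompt r x t.+1 = rcons (prompt r x t) (input_block x t.+1) ++
    [:: correct_verbalizer r x t.+1; delimiter lm].
Proof.
by rewrite /prompt -{1}[t.+1]addn1 iotaD map_cat flatten_cat /= add1n cat_rcons.
Qed.

Lemma prefix_prompt (R : realType) (Block Latent : choiceType) (Meaning : Type)
    (lm : language_model R Block Latent Meaning)
    (task : classification_task Block Meaning) (r : class task -> Gamma lm)
    (x : nat -> input task) (t u : nat) :
  (t <= u)%N -> prefix (prompt r x t) (prompt r x u).
Proof.
move=> /subnKC <-; elim: (u - t)%N => [|n IHn].
  by rewrite addn0 prefix_refl.
by rewrite addnS promptS cat_rcons prefix_catl.
Qed.

Theorem theorem4p1 (R : realType) (Block Latent : choiceType) (Meaning : Type)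
    (lm : language_model R Block Latent Meaning)
    (task : classification_task Block Meaning)
    (r : class task -> Gamma lm)
    (zstar : Latent) (zstar_represents : represents r zstar)
    (x : nat -> input task) (T : nat) (T_gt0 : (0 < T)%N)
    (prior_zstar_gt0 : 0 < prior lm zstar)
    (prompt_gt0 : 0 < Pr_given lm zstar (prompt r x T)) :
  let d := delimiter lm in
  let X := input_block x in
  let V := correct_verbalizer r x in
  let S := prompt r x in
  T%:R^-1 * \sum_(1 <= t < T.+1)
      ln (Pr_next lm (rcons (S t.-1) (X t)) [:: V t])
  >= T%:R^-1 * ln (prior lm zstar)
   + T%:R^-1 * \sum_(1 <= t < T.+1)
      ln (Pr_next_given lm zstar (rcons (S t.-1) (X t)) [:: V t; d])
   + T%:R^-1 * \sum_(1 <= t < T.+1)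
      ln (Pr_next_given lm zstar (S t.-1) [:: X t]
          / Pr_next lm (S t.-1) [:: X t]).
Proof.
cbv zeta; set d := delimiter lm; set X := input_block x.
set V := correct_verbalizer r x; set S := prompt r x.
rewrite -!mulrDr ler_wpM2l ?invr_ge0 ?ler0n//.
pose m := Pr_joint lm [set: Latent]; pose g := Pr_joint lm [set zstar].
(* Positivity at the full prompt passes to its prefixes, since beginning with a prefix is a weaker
   event. *)
have g_gt0 s : prefix s (S T) -> 0 < g s.
  move=> sS; rewrite /g Pr_joint_set1 mulr_gt0//.
  exact: lt_le_trans prompt_gt0 (Pr_given_prefix _ _ sS).
have g_le_m s : g s <= m s by apply: Pr_joint_subset.
have m_gt0 s : prefix s (S T) -> 0 < m s.
  by move=> /g_gt0 /lt_le_trans; apply.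
pose f t := ln (m (S t)) - ln (g (S t)).
have f0 : f 0%N <= - ln (prior lm zstar).
  rewrite /f /g Pr_joint_set1 Pr_given_nil mulr1 gerDr.
  exact/ln_le0/Pr_joint_le1.
have fT : 0 <= f T by rewrite subr_ge0 ler_ln ?posrE ?g_gt0 ?m_gt0 ?prefix_refl.
(* All sums move to one side, and the index is shifted to start at 0, which removes the
   predecessors. *)
rewrite -addrA -big_split /= -lerBrDr -sumrB big_add1 /=.
suff le_f : \sum_(0 <= t < T) (f t.+1 - f t) <= \sum_(0 <= t < T)
    (ln (Pr_next lm (rcons (S t) (X t.+1)) [:: V t.+1])
     - (ln (Pr_next_given lm zstar (rcons (S t) (X t.+1)) [:: V t.+1; d])
        + ln (Pr_next_given lm zstar (S t) [:: X t.+1]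
              / Pr_next lm (S t) [:: X t.+1]))).
  apply: le_trans le_f; rewrite telescope_sumr//; lra.
apply: ler_sum_nat => t /andP[_ tT].
(* Only the extension of [S t] by the input becomes an [rcons], so that it coincides with the
   context of the verbalizer and the two can cancel. *)
rewrite /Pr_next /Pr_next_given (cats1 (S t)) -/m -/g -promptS -/S.
have prefS : prefix (S t.+1) (S T) by apply: prefix_prompt.
set sx := rcons _ _; set sxv := sx ++ _.
have pref_sxv : prefix sxv (S t.+1).
  by rewrite /S promptS -/sx -[[:: _; _]]cat1s catA prefix_prefix.
have pref_sx : prefix sx (S t.+1) by rewrite /S promptS prefix_prefix.
have pref_s : prefix (S t) (S t.+1) by apply: prefix_prompt.
have pos s : prefix s (S t.+1) -> (0 < g s) * (0 < m s).
  by move=> /prefix_trans /(_ prefS) sS; rewrite g_gt0 ?m_gt0.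
(* The only loss in a round: the left side does not ask for the delimiter after the verbalizer. *)
have m_sxv : ln (m (S t.+1)) <= ln (m sxv).
  by rewrite ler_ln ?posrE ?pos ?prefix_refl// Pr_joint_prefix.
(* Once the logarithms of quotients are expanded, the terms at [sx] cancel for both [g] and [m],
   leaving [m_sxv]. *)
rewrite !ln_div ?posrE ?divr_gt0 ?pos ?prefix_refl// /f; lra.
Qed.
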